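(* The axiom system $\mathsf{EKB}+(B\varphi\to BE\varphi)$ is sound and complete for $\mathcal{L}_{E,K,B}$ with respect to the class of evidence models satisfying (E1) and (E2) under doxastic-evidence semantics.
   Context: $\mathcal{L}_{E,K,B}$ is generated by $\phi ::= p \mid \neg\phi \mid \phi\wedge\psi \mid E\phi \mid K\phi \mid B\phi$. An evidence model is $(X,\mathcal{E},I,v)$ with $X$ nonempty, $\mathcal{E}$ nonempty, $I_e:X\to 2^X$, $v:\textsc{prop}\to 2^X$; $U_e=\{x : x\in I_e(x)\}$. (E1): $y\in I_e(x)$ implies $y\in I_e(y)$. A doxastic evidence scenario is $(x,e,V)$ with $x\in U_e$ and $\emptyset\neq V\subseteq U_e$. Condition (E2) is a constraint on the doxastic evidence scenarios used: $y\in V$ implies $I_e(y)\subseteq V$; validity in the class in question means truth at every doxastic evidence scenario $(x,e,V)$ satisfying (E2) of every evidence model satisfying (E1). Doxastic-evidence semantics: $p$ via $v$; Booleans as usual; $(x,e,V)\models E\phi$ iff $I_e(x)\subseteq[\![\phi]\!]^{e,V}$; $(x,e,V)\models K\phi$ iff $U_e\subseteq[\![\phi]\!]^{e,V}$; $(x,e,V)\models B\phi$ iff $V\subseteq[\![\phi]\!]^{e,V}$, where $[\![\phi]\!]^{e,V}=\{y\in U_e : (y,e,V)\models\phi\}$. $\mathsf{EKB}$: classical propositional logic with modus ponens; $\mathsf{S5}$ for $K$; $\mathsf{KT}$ for $E$; $K\phi\to E\phi$; $B(\phi\to\psi)\to(B\phi\to B\psi)$; $B\phi\to\neg B\neg\phi$;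 $B\phi\to KB\phi$; $K\phi\to B\phi$. *)

(* Defs.v *)
From mathcomp Require Import all_boot.
From mathcomp Require Import boolp classical_sets.

Set Implicit Arguments.
Unset Strict Implicit.
Unset Printing Implicit Defensive.

Local Open Scope classical_set_scope.

Inductive form (A : Type) : Type :=
| Var of A
| Neg of form A
| And of form A & form A
| Evid of form A   (* E *)
| Know of form A   (* K *)
| Bel of form A.   (* B *)

Definition Imp (A : Type) (phi psi : form A) : form A := Neg (And phi (Neg psi)).

Record evidence_model (A : Type) := EvidenceModel {
  world : Type;
  evidence : Type;
  world_inh : inhabited world;
  evidence_inh : inhabited evidence;
  info : evidence -> world -> set world;   (* info e x is I_e(x) *)
  valuation : A -> set world
}.
Arguments valuation {A} M p : rename.

Definition U (A : Type) (M : evidence_model A) (e : evidence M) : set (world M) :=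
  [set x | info e x x].

Definition E1 (A : Type) (M : evidence_model A) : Prop :=
  forall (e : evidence M) (x y : world M), info e x y -> info e y y.

Definition scenario (A : Type) (M : evidence_model A)
    (x : world M) (e : evidence M) (V : set (world M)) : Prop :=
  [/\ U e x, V !=set0 & V `<=` U e].

Definition E2 (A : Type) (M : evidence_model A)
    (e : evidence M) (V : set (world M)) : Prop :=
  forall y : world M, V y -> info e y `<=` V.

(* [sat e V phi x] is (x, e, V) |= phi; it is meaningful when (x, e, V) is a
   scenario.  The truth set [[phi]]^{e,V} is [U e `&` sat e V phi]. *)
Fixpoint sat (A : Type) (M : evidence_model A) (e : evidence M)
    (V : set (world M)) (phi : form A) : set (world M) :=
  fun x => match phi with
  | Var p => valuation M p x
  | Neg psi => ~ sat e V psi x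
  | And psi chi => sat e V psi x /\ sat e V chi x
  | Evid psi => info e x `<=` U e `&` sat e V psi
  | Know psi => U e `<=` U e `&` sat e V psi
  | Bel psi => V `<=` U e `&` sat e V psi
  end.

Definition valid_E1_E2 (A : Type) (phi : form A) : Prop :=
  forall M : evidence_model A, E1 M ->
  forall (x : world M) (e : evidence M) (V : set (world M)),
    scenario x e V -> E2 e V -> sat e V phi x.

(* Boolean evaluation in which variables and modal formulas are atoms, so that
   [taut] holds exactly of the substitution instances of tautologies. *)
Fixpoint peval (A : Type) (v : form A -> bool) (phi : form A) : bool :=
  match phi with
  | Neg psi => ~~ peval v psi
  | And psi chi => peval v psi && peval v chi
  | _ => v phi
  end.

Definition taut (A : Type) (phi : form A) : Prop :=
  forall v : form A -> bool, peval v phi.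

(* Theorems of EKB extended with the axioms in [Ax].  Necessitation for B is
   not a primitive rule: it follows from that for K and [EKB_KB]. *)
Inductive EKB (A : Type) (Ax : set (form A)) : form A -> Prop :=
| EKB_taut phi : taut phi -> EKB Ax phi
| EKB_MP phi psi : EKB Ax (Imp phi psi) -> EKB Ax phi -> EKB Ax psi
| EKB_K_K phi psi :
    EKB Ax (Imp (Know (Imp phi psi)) (Imp (Know phi) (Know psi)))
| EKB_K_T phi : EKB Ax (Imp (Know phi) phi)
| EKB_K_4 phi : EKB Ax (Imp (Know phi) (Know (Know phi)))
| EKB_K_5 phi : EKB Ax (Imp (Neg (Know phi)) (Know (Neg (Know phi))))
| EKB_K_nec phi : EKB Ax phi -> EKB Ax (Know phi)
| EKB_E_K phi psi :
    EKB Ax (Imp (Evid (Imp phi psi)) (Imp (Evid phi) (Evid psi)))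
| EKB_E_T phi : EKB Ax (Imp (Evid phi) phi)
| EKB_E_nec phi : EKB Ax phi -> EKB Ax (Evid phi)
| EKB_KE phi : EKB Ax (Imp (Know phi) (Evid phi))
| EKB_B_K phi psi :
    EKB Ax (Imp (Bel (Imp phi psi)) (Imp (Bel phi) (Bel psi)))
| EKB_B_D phi : EKB Ax (Imp (Bel phi) (Neg (Bel (Neg phi))))
| EKB_BKB phi : EKB Ax (Imp (Bel phi) (Know (Bel phi)))
| EKB_KB phi : EKB Ax (Imp (Know phi) (Bel phi))
| EKB_extra phi : Ax phi -> EKB Ax phi.

Definition BBE (A : Type) : set (form A) :=
  [set psi | exists phi, psi = Imp (Bel phi) (Bel (Evid phi))].
Arguments BBE : clear implicits.

(* Main.v *)
From mathcomp Require Import all_boot.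
From mathcomp Require Import boolp classical_sets.
Require Import Defs.

Set Implicit Arguments.
Unset Strict Implicit.
Unset Printing Implicit Defensive.

Local Open Scope classical_set_scope.

(** Completeness goes through a canonical model cut down to one [Know]-cluster:
    fix a maximal consistent set [G0] and take as worlds the maximal consistent
    sets containing every [psi] with [Know psi] in [G0].  There is a single piece
    of evidence, read off from [Evid], and [V] consists of the worlds containing
    every [psi] with [Bel psi] in [G0].  Axiom T for [Evid] makes every world
    factive, so (E1) is trivial and U is everything; the axiom
    [Bel psi -> Bel (Evid psi)] is exactly what closes [V] under evidence, that
    is, (E2).  Introspection makes [Know]- and [Bel]-formulas constant over the
    cluster, whence the truth lemma. *)

(** * Soundness in a fixed scenario *)

Section Soundness.

Variables (A : Type) (M : evidence_model A).
Variables (e : evidence M) (V : set (world M)).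

Lemma sat_Imp (phi psi : form A) (x : world M) :
  sat e V (Imp phi psi) x <-> (sat e V phi x -> sat e V psi x).
Proof.
split=> /= [h hphi|h [/h hpsi]]; last by apply.
by apply: contrapT => hpsi; apply: h.
Qed.

(** Truth at [x] is itself a Boolean valuation of the atoms of [peval], so [taut] can be
    instantiated with it. *)
Lemma peval_sat (phi : form A) (x : world M) :
  peval (fun psi => `[< sat e V psi x >]) phi = `[< sat e V phi x >].
Proof.
elim: phi => //= [phi ->|phi -> psi ->]; first by rewrite asbool_neg.
by rewrite asbool_and.
Qed.

Hypotheses (hE1 : E1 M) (hV0 : V !=set0) (hVU : V `<=` U e) (hE2 : E2 e V).

Lemma EKB_sound (phi : form A) :
  EKB (BBE A) phi -> forall x, U e x -> sat e V phi x.
Proof.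
elim=> {phi}.
- by move=> phi /(_ (fun psi => `[< sat e V psi _ >])) + x _;
     move/(_ x); rewrite peval_sat => /asboolP.
- by move=> phi psi _ ih1 _ ih2 x xU; move/sat_Imp: (ih1 x xU); apply; apply: ih2.
- move=> phi psi x xU; apply/sat_Imp => h1; apply/sat_Imp => h2 y yU.
  by split=> //; have [_ /sat_Imp] := h1 y yU; apply; have [] := h2 y yU.
- by move=> phi x xU; apply/sat_Imp => /(_ x xU) [].
- by move=> phi x xU; apply/sat_Imp => h y yU; split.
- by move=> phi x xU; apply/sat_Imp => h y yU; split.
- by move=> phi _ ih x xU y yU; split=> //; apply: ih.
- move=> phi psi x xU; apply/sat_Imp => h1; apply/sat_Imp => h2 y xy.
  have [yU /sat_Imp h] := h1 y xy.
  by split=> //; apply: h; have [] := h2 y xy.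
- by move=> phi x xU; apply/sat_Imp => /(_ x xU) [].
- move=> phi _ ih x xU y /hE1 yU.
  by split=> //; apply: ih.
- by move=> phi x xU; apply/sat_Imp => h y /hE1 yU; apply: h.
- move=> phi psi x xU; apply/sat_Imp => h1; apply/sat_Imp => h2 y yV.
  have [yU /sat_Imp h] := h1 y yV.
  by split=> //; apply: h; have [] := h2 y yV.
- move=> phi x xU; apply/sat_Imp => h1 h2; have [y yV] := hV0.
  by have [_ hphi] := h1 y yV; have [_] := h2 y yV; apply.
- by move=> phi x xU; apply/sat_Imp => h y yU; split.
- by move=> phi x xU; apply/sat_Imp => h y /hVU; apply: h.
(* By (E2), evidence at a point of [V] stays in [V], where [phi] is believed. *)
- move=> _ [phi ->] x xU; apply/sat_Imp => h y yV.
  by split=> [|z yz]; [apply: hVU|apply: h; apply: hE2 yz].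
Qed.

End Soundness.

(** * Derivability and Lindenbaum's lemma, for arbitrary extra axioms *)

Section Lindenbaum.

Variables (A : Type) (Ax : set (form A)).
Implicit Types (G D : set (form A)) (phi psi chi : form A).

(* Modal rules apply only to theorems, never to the premises in [G]. *)
Inductive Der G : form A -> Prop :=
| Der_thm phi : EKB Ax phi -> Der G phi
| Der_hyp phi : G phi -> Der G phi
| Der_MP phi psi : Der G (Imp phi psi) -> Der G phi -> Der G psi.

Definition consistent G := forall phi, Der G phi -> ~ Der G (Neg phi).

Definition mcs G := consistent G /\ forall phi, G phi \/ G (Neg phi).

Lemma Der_sub G D phi : G `<=` D -> Der G phi -> Der D phi.
Proof.
move=> GD; elim=> {}phi; first exact: Der_thm.
  by move=> /GD; apply: Der_hyp.
by move=> psi _ h1 _ h2; apply: Der_MP h1 h2.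
Qed.

Lemma Der_set0 phi : Der set0 phi -> EKB Ax phi.
Proof. by elim=> {}phi // psi _ h1 _ h2; apply: EKB_MP h1 h2. Qed.

Lemma Der_taut1 G phi psi : taut (Imp phi psi) -> Der G phi -> Der G psi.
Proof. by move=> t; apply/Der_MP/Der_thm/EKB_taut. Qed.

Lemma Der_taut2 G phi psi chi :
  taut (Imp phi (Imp psi chi)) -> Der G phi -> Der G psi -> Der G chi.
Proof. by move=> t h; apply: Der_MP; apply: Der_taut1 t h. Qed.

Lemma deduction G phi psi : Der (G `|` [set phi]) psi -> Der G (Imp phi psi).
Proof.
elim=> {}psi.
- move=> /(Der_thm G); apply: Der_taut1 => v /=.
  by case: (peval v psi); rewrite ?andbF.
- case=> [/Der_hyp|-> ].
    by apply: Der_taut1 => v /=; case: (peval v psi); rewrite ?andbF.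
  by apply/Der_thm/EKB_taut => v /=; case: (peval v phi).
- move=> chi _ h1 _ h2; apply: Der_taut2 h1 h2 => v /=.
  by case: (peval v phi); case: (peval v psi); case: (peval v chi).
Qed.

Lemma inconsistentU1 G phi : ~ consistent (G `|` [set phi]) -> Der G (Neg phi).
Proof.
move=> h; apply: contrapT => nG; apply: h => psi /deduction h1 /deduction h2.
apply: nG; apply: Der_taut2 h1 h2 => v /=.
by case: (peval v phi); case: (peval v psi).
Qed.

Lemma consistentU1N G psi : ~ Der G psi -> consistent (G `|` [set Neg psi]).
Proof.
move=> nG; apply: contrapT => /inconsistentU1 h; apply: nG.
by apply: Der_taut1 h => v /=; case: (peval v psi).
Qed.

(* Allowing [X = set0] covers the empty chain. *)
Lemma Der_chain G (F : set (set (form A))) phi :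
  total_on F (fun X Y => X `<=` Y) -> Der (G `|` \bigcup_(X in F) X) phi ->
  exists2 X, (set0 |` F) X & Der (G `|` X) phi.
Proof.
move=> tF; elim=> {}phi.
- by move=> h; exists set0; [left|apply: Der_thm].
- case=> [Gphi|[X FX Xphi]]; first by exists set0; [left|apply: Der_hyp; left].
  by exists X; [right|apply: Der_hyp; right].
- move=> psi _ [X FX h1] _ [Y FY h2].
  have [XY|YX] : X `<=` Y \/ Y `<=` X.
    case: FX => [->|FX]; first by left.
    by case: FY => [->|FY]; [right|exact: tF].
  + by exists Y => //; apply: Der_MP h2; apply: Der_sub h1; apply: setUS.
  + by exists X => //; apply: Der_MP h1 _; apply: Der_sub h2; apply: setUS.
Qed.

Lemma lindenbaum G : consistent G -> exists2 D, mcs D & G `<=` D.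
Proof.
(* Zorn runs over the sets consistent jointly with [G] rather than over supersets of [G], so that
   the empty union of the empty chain qualifies. *)
move=> cG; pose P X := consistent (G `|` X).
have P0 : P set0 by rewrite /P setU0.
have [F FP tF|X [PX maxX]] := @Zorn_bigcup (form A) P.
  move=> phi h1 h2.
  (* Packing the contradiction into one formula lets a single member of the chain derive both
     halves. *)
  have {h1 h2} : Der (G `|` \bigcup_(X in F) X) (And phi (Neg phi)).
    by apply: Der_taut2 h1 h2 => v /=; case: (peval v phi).
  move=> /(Der_chain tF) [X FX h].
  have cX : P X by case: FX => [->|/FP].
  apply: (cX phi); apply: Der_taut1 h => v /=; by case: (peval v phi).
have memX phi : consistent ((G `|` X) `|` [set phi]) -> X phi.
  rewrite -setUA => c; apply: contrapT => nX.
  apply: (maxX (X `|` [set phi])) => //; split; first exact: subsetUl.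
  by move=> /(_ phi) h; apply: nX; apply: h; right.
exists (G `|` X); last exact: subsetUl.
split=> // phi.
have [c|/inconsistentU1 h] := pselect (consistent ((G `|` X) `|` [set phi])).
  by left; right; apply: memX.
(* [Neg phi] is already derivable, so adding it preserves consistency. *)
right; right; apply: memX => psi h1 h2.
apply: (PX psi).
  by apply: Der_MP h; apply: deduction.
by apply: Der_MP h; apply: deduction.
Qed.

(** * Maximal consistent sets and the existence lemma for a normal modality *)

Section MaximalConsistent.

Variables (G : set (form A)) (mG : mcs G).

Lemma mcs_Der phi : Der G phi -> G phi.
Proof. by move=> h; case: (mG.2 phi) => // /Der_hyp /(mG.1 _ h). Qed.

Lemma mcs_imp phi psi : EKB Ax (Imp phi psi) -> G phi -> G psi.
Proof.
by move=> h Gphi; apply/mcs_Der/(Der_MP (Der_thm _ h))/Der_hyp.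
Qed.

Lemma mcs_Neg phi : G (Neg phi) <-> ~ G phi.
Proof.
split=> [/Der_hyp h1 /Der_hyp h2|]; first exact: mG.1 h2 h1.
by case: (mG.2 phi).
Qed.

Lemma mcs_And phi psi : G (And phi psi) <-> G phi /\ G psi.
Proof.
split=> [h|[/Der_hyp h1 /Der_hyp h2]].
  split; apply: mcs_imp h; apply: EKB_taut => v /=;
    by case: (peval v phi); case: (peval v psi).
apply/mcs_Der/(Der_taut2 _ h1 h2) => v /=.
by case: (peval v phi); case: (peval v psi).
Qed.

Variable box : form A -> form A.
Hypothesis box_K : forall phi psi,
  EKB Ax (Imp (box (Imp phi psi)) (Imp (box phi) (box psi))).
Hypothesis box_nec : forall phi, EKB Ax phi -> EKB Ax (box phi).

(** The derivation is replayed under [box]: necessitation handles theorems, axiom K handles modus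
    ponens. *)
Lemma Der_unbox psi : Der [set chi | G (box chi)] psi -> G (box psi).
Proof.
elim=> {}psi.
- by move=> /box_nec h; apply/mcs_Der/Der_thm.
- by [].
- move=> chi _ /(mcs_imp (box_K _ _)) /Der_hyp h1 _ /Der_hyp h2.
  by apply/mcs_Der/(Der_MP h1 h2).
Qed.

Lemma mcs_box_existence psi : ~ G (box psi) ->
  exists D, [/\ mcs D, forall chi, G (box chi) -> D chi & ~ D psi].
Proof.
move=> nG.
have /lindenbaum[D mD sub] :
    consistent ([set chi | G (box chi)] `|` [set Neg psi]).
  by apply: consistentU1N => /Der_unbox.
exists D; split=> // [chi ?|Dpsi]; first by apply: sub; left.
apply: (mD.1 psi); apply: Der_hyp => //.
by apply: sub; right.
Qed.

End MaximalConsistent.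

Lemma Bel_nec phi : EKB Ax phi -> EKB Ax (Bel phi).
Proof. by move=> /EKB_K_nec; apply/EKB_MP/EKB_KB. Qed.

End Lindenbaum.

(** * The canonical model on one cluster *)

Section Canonical.

Variable A : Type.
Notation mcs := (mcs (BBE A)).
Variables (G0 : set (form A)) (mG0 : mcs G0).

Definition cluster :=
  {G : set (form A) | mcs G /\ forall psi, G0 (Know psi) -> G psi}.

Definition cluster_root : cluster :=
  exist _ G0 (conj mG0 (fun psi => mcs_imp mG0 (EKB_K_T _ psi))).

Definition canonical : evidence_model A :=
  @EvidenceModel A cluster unit (inhabits cluster_root) (inhabits tt)
    (fun _ w => [set w' | forall psi, sval w (Evid psi) -> sval w' psi])
    (fun p => [set w | sval w (Var p)]).

Definition believed : set (world canonical) :=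
  [set w | forall psi, G0 (Bel psi) -> sval w psi].

(** Axiom 4 carries [Know psi] from [G0] to [w]; axiom 5 does the same for its negation. *)
Lemma cluster_Know (w : cluster) psi : sval w (Know psi) <-> G0 (Know psi).
Proof.
case: w => G [mG KG] /=; split=> [h|/(mcs_imp mG0 (EKB_K_4 _ _))]; last exact: KG.
apply: contrapT => /(mcs_Neg mG0) /(mcs_imp mG0 (EKB_K_5 _ _)) /KG.
by move=> /(mcs_Neg mG).
Qed.

(** [Bel psi] travels both ways as [Know (Bel psi)], which is constant on the cluster. *)
Lemma cluster_Bel (w : cluster) psi : sval w (Bel psi) <-> G0 (Bel psi).
Proof.
have mw := (svalP w).1; split.
  move=> /(mcs_imp mw (EKB_BKB _ _)) /cluster_Know.
  exact: (mcs_imp mG0 (EKB_K_T _ _)).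
by move=> /(mcs_imp mG0 (EKB_BKB _ _)); apply: (svalP w).2.
Qed.

Lemma canonical_U (w : world canonical) : U (tt : evidence canonical) w.
Proof. by move=> psi; apply: (mcs_imp (svalP w).1); apply: EKB_E_T. Qed.

Lemma canonical_E1 : E1 canonical.
Proof. by move=> [] _ w _; apply: canonical_U. Qed.

Lemma canonical_E2 : E2 (tt : evidence canonical) believed.
Proof.
move=> w wV w' ww' psi h; apply: ww'; apply: wV.
by apply: (mcs_imp mG0) h; apply: EKB_extra; exists psi.
Qed.

Lemma believed_Bel psi : believed `<=` [set w | sval w psi] <-> G0 (Bel psi).
Proof.
split=> [h|h w]; last exact.
apply: contrapT => nB.
have [D [mD BD nD]] :=
  mcs_box_existence mG0 (@EKB_B_K _ _) (@Bel_nec _ _) nB.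
(* Knowledge implies belief, so [D] lies in the cluster. *)
have KD chi : G0 (Know chi) -> D chi.
  by move=> /(mcs_imp mG0 (EKB_KB _ _)); apply: BD.
exact/nD/(h (exist _ D (conj mD KD))).
Qed.

Lemma believed_neq0 : believed !=set0.
Proof.
apply: contrapT => V0.
have allB psi : G0 (Bel psi).
  by apply/believed_Bel => w wV; case: V0; exists w.
(* The root is a nominal witness: having all of [Bel psi] and [Bel (Neg psi)] in [G0] already
   contradicts axiom D. *)
apply: V0; exists cluster_root => psi _.
by have /(mcs_imp mG0 (EKB_B_D _ _)) /(mcs_Neg mG0) := allB psi; case.
Qed.

Lemma truth_lemma psi (w : world canonical) :
  sat (tt : evidence canonical) believed psi w <-> sval w psi.
Proof.
elim: psi w => [p|psi ih|psi ih1 chi ih2|psi ih|psi ih|psi ih] w //=;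
  have mw := (svalP w).1.
- split=> [h|/(mcs_Neg mw) h /ih //].
  by apply/(mcs_Neg mw) => /ih.
- by split=> [[/ih1 h1 /ih2 h2]|/(mcs_And mw) [/ih1 h1 /ih2 h2]] //;
     apply/(mcs_And mw).
- split=> [h|h w' ww'].
    apply: contrapT => nE.
    have [D [mD ED nD]] :=
      mcs_box_existence mw (@EKB_E_K _ _) (@EKB_E_nec _ _) nE.
    (* Knowledge implies evidence, so the evidence successor [D] stays in the cluster. *)
    have KD chi : G0 (Know chi) -> D chi.
      by move=> /(cluster_Know w) /(mcs_imp mw (EKB_KE _ _)); apply: ED.
    have [_ /ih] := h (exist _ D (conj mD KD)) ED.
    exact: nD.
  by split; [apply: canonical_U|apply/ih/ww'].
(* The truth conditions of [Know] and [Bel] do not depend on [w], so both cases are decided at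
   [G0]. *)
- rewrite cluster_Know; split=> [h|h w' _].
    apply: contrapT => nK.
    have [D [mD KD nD]] :=
      mcs_box_existence mG0 (@EKB_K_K _ _) (@EKB_K_nec _ _) nK.
    have [_ /ih] := h (exist _ D (conj mD KD)) (@canonical_U _).
    exact: nD.
  by split; [apply: canonical_U|apply/ih; apply: (svalP w').2].
- rewrite cluster_Bel -believed_Bel; split=> h w' w'V.
    by have [_ /ih] := h w' w'V.
  by split; [apply: canonical_U|apply/ih/h].
Qed.

End Canonical.

Theorem theorem5 (A : Type) (phi : form A) : EKB (BBE A) phi <-> valid_E1_E2 phi.
Proof.
split=> [h M hE1 x e V [xU V0 VU] hE2|h]; first exact: EKB_sound h _ xU.
apply: contrapT => nphi.
have /lindenbaum[G mG sub] : consistent (BBE A) (set0 `|` [set Neg phi]).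
  by apply: consistentU1N => /Der_set0.
have /(mcs_Neg mG) : G (Neg phi) by apply: sub; right.
apply; apply: (truth_lemma phi (cluster_root mG : world (canonical mG))).1.
apply: h; [exact: canonical_E1| |exact: canonical_E2].
split; [exact: canonical_U|exact: believed_neq0|].
by move=> w _; apply: canonical_U.
Qed.
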